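(* Let $\mathcal A$ and $\mathcal B$ be $^*$-algebras over $\mathsf C$. If $\mathfrak X$ is a non-degenerate $(\mathcal B$-$\mathcal A)$-equivalence bimodule, then the Rieffel induction functors $\mathfrak R_{\mathfrak X}$ and $\mathfrak R_{\overline{\mathfrak X}}$ (restricted to strongly non-degenerate $^*$-representations) define an equivalence of categories between ${}^*\text{-}\mathsf{Rep}(\mathcal A)$ and ${}^*\text{-}\mathsf{Rep}(\mathcal B)$.
   Context: $\mathsf R$ is an ordered ring (commutative ring with $1\ne0$ and a subset $\mathsf P$ closed under sums and products such that $\mathsf R$ is the disjoint union $-\mathsf P\cup\{0\}\cup\mathsf P$), and $\mathsf C=\mathsf R(\mathrm i)=\mathsf R\oplus\mathrm i\mathsf R$, $\mathrm i^2=-1$, with the usual conjugation. A $^*$-algebra over $\mathsf C$ is an associative (not necessarily unital) $\mathsf C$-algebra with an antilinear involution satisfying $(AB)^*=B^*A^*$. A linear $\omega:\mathcal A\to\mathsf C$ is positive if $\omega(A^*A)\ge0$ for all $A$; a Hermitian $A$ is positive ($A\ge0$) if $\omega(A)\ge0$ for all positive linear functionals $\omega$. A pre-Hilbert space over $\mathsf C$ is a $\mathsf C$-module with a Hermitian inner product (linear in the second argument), $\langle\phi,\phi\rangle\ge0$, and $\langle\phi,\phi\rangle=0\Rightarrow\phi=0$. A $^*$-representation is a $^*$-homomorphism $\pi$ into the adjointable endomorphisms of a pre-Hilbert space $\mathfrak H$; it is strongly non-degenerate if the $\mathsf C$-span of all $\pi(A)\phi$ is $\mathfrak H$. ${}^*\text{-}\mathsf{Rep}(\mathcal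 A)$ is the category of strongly non-degenerate $^*$-representations of $\mathcal A$, with isometric (alternatively: adjointable, or unitary) intertwiners as morphisms (the same choice for both algebras). A $(\mathcal B$-$\mathcal A)$-equivalence bimodule is a $\mathsf C$-module $\mathfrak X$ with commuting left $\mathcal B$- and right $\mathcal A$-actions and maps $\langle\cdot,\cdot\rangle_{\mathcal A}:\mathfrak X\times\mathfrak X\to\mathcal A$, ${}_{\mathcal B}\langle\cdot,\cdot\rangle:\mathfrak X\times\mathfrak X\to\mathcal B$ such that: E1) X1) $\langle\cdot,\cdot\rangle_{\mathcal A}$ is $\mathsf C$-linear in the second argument; X2) $\langle x,y\rangle_{\mathcal A}=\langle y,x\rangle_{\mathcal A}^*$; X3) $\langle x,y\cdot A\rangle_{\mathcal A}=\langle x,y\rangle_{\mathcal A}A$; X4) $\langle x,x\rangle_{\mathcal A}\ge0$; X5) $\langle x,B\cdot y\rangle_{\mathcal A}=\langle B^*\cdot x,y\rangle_{\mathcal A}$; X6) the $\mathsf C$-span of all $\langle x,y\rangle_{\mathcal A}$ is $\mathcal A$. E2) Y1) ${}_{\mathcal B}\langle\cdot,\cdot\rangle$ is $\mathsf C$-linear in the first argument; Y2) ${}_{\mathcal B}\langle x,y\rangle={}_{\mathcal B}\langle y,x\rangle^*$; Y3) ${}_{\mathcal B}\langle B\cdot x,y\rangle=B\,{}_{\mathcal B}\langle x,y\rangle$; Y4) ${}_{\mathcal B}\langle x,x\rangle\ge0$; Y5) ${}_{\mathcal B}\langle x\cdot A,y\rangle={}_{\mathcal B}\langle x,y\cdot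 A^*\rangle$; Y6) the $\mathsf C$-span of all ${}_{\mathcal B}\langle x,y\rangle$ is $\mathcal B$. E3) ${}_{\mathcal B}\langle x,y\rangle\cdot z=x\cdot\langle y,z\rangle_{\mathcal A}$. E4) P): for every $^*$-representation $(\mathfrak H,\pi)$ of $\mathcal A$ the form $\langle x\otimes\psi,y\otimes\phi\rangle=\langle\psi,\pi(\langle x,y\rangle_{\mathcal A})\phi\rangle$ on $\mathfrak X\otimes_{\mathcal A}\mathfrak H$ is positive semi-definite; and Q): P holds for the conjugate $(\mathcal A$-$\mathcal B)$-bimodule $\overline{\mathfrak X}$ (conjugate $\mathsf C$-module, $A\bar x=\overline{xA^*}$, $\bar xB=\overline{B^*x}$) with $\langle\bar x,\bar y\rangle_{\mathcal B}={}_{\mathcal B}\langle x,y\rangle$. It is non-degenerate if the $\mathsf C$-span of all $B\cdot x$ is $\mathfrak X$ and the $\mathsf C$-span of all $x\cdot A$ is $\mathfrak X$. The functor $\mathfrak R_{\mathfrak X}$ sends a $^*$-representation $(\mathfrak H,\pi)$ of $\mathcal A$ to $\mathfrak K=\widetilde{\mathfrak K}/\widetilde{\mathfrak K}^\perp$, $\widetilde{\mathfrak K}=\mathfrak X\otimes_{\mathcal A}\mathfrak H$ with the form above, with $\mathcal B$ acting by $B[x\otimes\psi]=[B\cdot x\otimes\psi]$, and an intertwiner $U$ to $[x\otimes\psi]\mapsto[x\otimes U\psi]$. $\mathfrak R_{\overline{\mathfrak X}}$ is defined in the same way from the $(\mathcal A$-$\mathcal B)$-bimodule $\overline{\mathfrak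 X}$ and goes from representations of $\mathcal B$ to representations of $\mathcal A$. For non-degenerate $\mathfrak X$ these functors take values in strongly non-degenerate $^*$-representations. *)

(* Defs.v *)
From HB Require Import structures.
From mathcomp Require Import all_boot all_order all_algebra.
From mathcomp Require Import boolp ring lra.
From mathcomp.real_closed Require Import complex.
From mathcomp.multinomials Require Import freeg.

Set Implicit Arguments.
Unset Strict Implicit.
Unset Printing Implicit Defensive.

Import Order.TTheory GRing.Theory Num.Theory.

Local Open Scope ring_scope.
Local Open Scope quotient_scope.
Local Open Scope complex_scope.

Local Notation Re := complex.Re.
Local Notation Im := complex.Im.

(* An ordered ring is a [realDomainType]: 0 < x singles out the set P of
   positive elements.  Ordered rings have no zero divisors, so nothing is lost
   by [realDomainType] being an integral domain.

   [complex] provides a ring structure on [R[i]] only over a field, so the ring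
   extension R(i) of an ordered ring is a copy of [R[i]] with its own
   (identically defined) multiplication. *)
Definition cext (R : realDomainType) : Type := R[i].

Section Scalars.
Context (R : realDomainType).
Local Notation C := (cext R).

HB.instance Definition _ := GRing.Zmodule.copy C R[i].

Definition cmul (z w : C) : C := ComplexField.mulc z w.
Definition cone : C := 1 +i* 0.

Lemma cmulA : associative cmul. Proof. exact: ComplexField.mulcA. Qed.
Lemma cmulC : commutative cmul. Proof. exact: ComplexField.mulcC. Qed.
Lemma cmul1 : left_id cone cmul.
Proof. by case=> a b; rewrite /cmul /= !mul1r !mul0r subr0 addr0. Qed.
Lemma cmulDl : left_distributive cmul +%R.
Proof.
move=> [a b] [c d] [e f]; rewrite -[_ + _]/((a + c) +i* (b + d)).
rewrite -[_ + _ in RHS]/((_ + _) +i* (_ + _)) /cmul /=.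
by congr Complex; ring.
Qed.
Lemma cone_neq0 : cone != 0.
Proof. by rewrite eq_complex /= oner_eq0. Qed.

HB.instance Definition _ := GRing.Zmodule_isComNzRing.Build C
  cmulA cmulC cmul1 cmulDl cone_neq0.

Definition cconj (z : C) : C := Re z -i* Im z.

Definition cge0 (z : C) : Prop := Im z = 0 /\ 0 <= Re z.

Lemma cP (z w : C) : Re z = Re w -> Im z = Im w -> z = w.
Proof. by case: z w => [a b] [c d] /= -> ->. Qed.

Lemma cReD (z w : C) : Re (z + w) = Re z + Re w.
Proof. by case: z w => [a b] [c d]. Qed.
Lemma cImD (z w : C) : Im (z + w) = Im z + Im w.
Proof. by case: z w => [a b] [c d]. Qed.
Lemma cReM (z w : C) : Re (z * w) = Re z * Re w - Im z * Im w.
Proof. by case: z w => [a b] [c d]. Qed.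
Lemma cImM (z w : C) : Im (z * w) = Re z * Im w + Im z * Re w.
Proof. by case: z w => [a b] [c d]. Qed.

Lemma cconjK : involutive cconj.
Proof. by case=> a b; rewrite /cconj /= opprK. Qed.
Lemma cconjD (z w : C) : cconj (z + w) = cconj z + cconj w.
Proof. by apply: cP; rewrite /= ?cReD ?cImD //= opprD. Qed.
Lemma cconjM (z w : C) : cconj (z * w) = cconj z * cconj w.
Proof.
by apply: cP; rewrite /= ?cReM ?cImM /= ?mulrNN // mulrN mulNr opprD.
Qed.
Lemma cconj0 : cconj 0 = 0. Proof. by apply: cP; rewrite //= oppr0. Qed.
Lemma cconj1 : cconj 1 = 1. Proof. by apply: cP; rewrite //= oppr0. Qed.

End Scalars.

Section LinearAlgebra.
Context (R : realDomainType).
Local Notation C := (cext R).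

Definition cspan (V : lmodType C) (S : V -> Prop) (v : V) : Prop :=
  exists s : seq (C * V),
    (forall p, p \in s -> S p.2) /\ v = \sum_(p <- s) p.1 *: p.2.

Record submodule (V : lmodType C) := Submodule {
  sub_pred :> V -> Prop;
  sub0 : sub_pred 0;
  subL : forall c u v, sub_pred u -> sub_pred v -> sub_pred (c *: u + v)
}.

Section Span.
Context (V : lmodType C) (S : V -> Prop).

Lemma span0 : cspan S 0.
Proof. by exists [::]; rewrite big_nil. Qed.

Lemma spanL c u v : cspan S u -> cspan S v -> cspan S (c *: u + v).
Proof.
move=> [s [sS ->]] [t [tS ->]]; exists ([seq (c * p.1, p.2) | p <- s] ++ t).
split=> [p|].
  by rewrite mem_cat => /orP[/mapP[q /sS qS ->]|/tS].
rewrite big_cat big_map /= scaler_sumr; congr (_ + _).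
by apply: eq_bigr => p _; rewrite scalerA.
Qed.

Lemma span_gen v : S v -> cspan S v.
Proof.
move=> Sv; exists [:: (1, v)]; split=> [p|]; last by rewrite big_seq1 scale1r.
by rewrite mem_seq1 => /eqP ->.
Qed.

Lemma span_ind (P : V -> Prop) :
  P 0 -> (forall c u v, S u -> P v -> P (c *: u + v)) ->
  forall v, cspan S v -> P v.
Proof.
move=> P0 PL v [s [sS ->]]; elim: s sS => [|p s IH] sS; first by rewrite big_nil.
rewrite big_cons; apply: PL; first by apply: sS; rewrite mem_head.
by apply: IH => q qs; apply: sS; rewrite in_cons qs orbT.
Qed.

Definition span_sub : submodule V := Submodule span0 spanL.

End Span.

Section Quotient.
Context (V : lmodType C) (W : submodule V).

Definition sub_bool (v : V) : bool := `[< W v >].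

Lemma subN v : W v -> W (- v).
Proof. by move=> Wv; rewrite -scaleN1r -[_ *: _]addr0; apply: subL => //; apply: sub0. Qed.

Lemma sub_bool_zmod : zmod_closed sub_bool.
Proof.
split; first by apply/asboolP; apply: sub0.
move=> u v /asboolP Wu /asboolP Wv; apply/asboolP.
by rewrite -[u]scale1r; apply: subL => //; apply: subN.
Qed.

HB.instance Definition _ := GRing.isZmodClosed.Build V sub_bool sub_bool_zmod.

Definition sub_zmod : zmodClosed V := GRing.ZmodClosed.clone V sub_bool _.

Definition lquot : Type := {ideal_quot sub_zmod}.

HB.instance Definition _ := GRing.Zmodule.on lquot.

Definition qpi (v : V) : lquot := \pi_{ideal_quot sub_zmod} v.
Definition qrepr (s : lquot) : V := repr (s : {ideal_quot sub_zmod}).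

Lemma qreprK s : qpi (qrepr s) = s. Proof. exact: reprK. Qed.

Lemma qpiP u v : qpi u = qpi v <-> W (u - v).
Proof.
split=> [/eqP|Wuv].
  by rewrite -[_ == _]Quotient.idealrBE => /asboolP.
by apply/eqP; rewrite -[_ == _]Quotient.idealrBE; apply/asboolP.
Qed.

Lemma qpiD u v : qpi (u + v) = qpi u + qpi v.
Proof. by rewrite /qpi !piE. Qed.

Lemma qpi0 : qpi 0 = 0.
Proof. by apply: (@addrI _ (qpi 0)); rewrite -qpiD !addr0. Qed.

Lemma qrepr_pi v : W (qrepr (qpi v) - v).
Proof. by apply/qpiP; rewrite qreprK. Qed.

Definition qscale (c : C) (s : lquot) : lquot := qpi (c *: qrepr s).

Lemma qscale_pi c v : qscale c (qpi v) = qpi (c *: v).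
Proof.
apply/qpiP; rewrite -scalerBr -[_ *: _]addr0.
by apply: subL; [apply: qrepr_pi | apply: sub0].
Qed.

Lemma qscaleA a b s : qscale a (qscale b s) = qscale (a * b) s.
Proof. by rewrite -[s]qreprK !qscale_pi scalerA. Qed.
Lemma qscale1 : left_id 1 qscale.
Proof. by move=> s; rewrite -[s]qreprK !qscale_pi scale1r. Qed.
Lemma qscaleDr : right_distributive qscale +%R.
Proof.
by move=> c s t; rewrite -[s]qreprK -[t]qreprK -qpiD !qscale_pi scalerDr qpiD.
Qed.
Lemma qscaleDl s : {morph qscale^~ s : a b / a + b}.
Proof. by move=> a b; rewrite -[s]qreprK !qscale_pi scalerDl qpiD. Qed.

HB.instance Definition _ := GRing.Zmodule_isLmodule.Build C lquot
  qscaleA qscale1 qscaleDr qscaleDl.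

Lemma qpiL c u v : qpi (c *: u + v) = c *: qpi u + qpi v.
Proof. by rewrite qpiD -qscale_pi. Qed.

End Quotient.
End LinearAlgebra.

Section StarAlgebras.
Context (R : realDomainType).
Local Notation C := (cext R).

Record starAlgebra := StarAlgebra {
  alg_mod :> lmodType C;
  amul : alg_mod -> alg_mod -> alg_mod;
  astar : alg_mod -> alg_mod;
  amulA : associative amul;
  amul_linl : forall b, linear (amul^~ b);
  amul_linr : forall a, linear (amul a);
  astar_antilin : forall c a b, astar (c *: a + b) = cconj c *: astar a + astar b;
  astarK : involutive astar;
  astarM : forall a b, astar (amul a b) = amul (astar b) (astar a)
}.

Definition positive_functional (A : starAlgebra) (w : A -> C) : Prop :=
  scalar w /\ forall a, cge0 (w (amul (astar a) a)).

Definition positive_element (A : starAlgebra) (a : A) : Prop :=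
  astar a = a /\ forall w, positive_functional w -> cge0 (w a).

Record preHilbert := PreHilbert {
  hilb_mod :> lmodType C;
  inner : hilb_mod -> hilb_mod -> C;
  inner_lin : forall x, scalar (inner x);
  inner_sym : forall x y, inner x y = cconj (inner y x);
  inner_ge0 : forall x, cge0 (inner x x);
  inner_def : forall x, inner x x = 0 -> x = 0
}.

Definition is_adjoint (H K : preHilbert) (f : H -> K) (g : K -> H) : Prop :=
  forall x y, inner (f x) y = inner x (g y).

(* [rep_act] is a *-homomorphism into the adjointable endomorphisms of the
   space; [rep_star] says that [rep_act a] is adjointable and that its adjoint,
   which is unique, is [rep_act (astar a)]. *)
Record starRep (A : starAlgebra) := StarRep {
  rep_space :> preHilbert;
  rep_act : A -> rep_space -> rep_space;
  rep_linr : forall a, linear (rep_act a);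
  rep_linl : forall x, linear (rep_act^~ x);
  rep_mul : forall a b x, rep_act (amul a b) x = rep_act a (rep_act b x);
  rep_star : forall a, is_adjoint (rep_act a) (rep_act (astar a))
}.

Definition strongly_nondegenerate (A : starAlgebra) (H : starRep A) : Prop :=
  forall x : H, cspan (fun y => exists a (z : H), y = rep_act a z) x.

Record sndRep (A : starAlgebra) := SndRep {
  snd_rep :> starRep A;
  snd_nondeg : strongly_nondegenerate snd_rep
}.

(* The three choices of morphisms in the category of *-representations. *)
Inductive intertwiner_kind := Isometric | Adjointable | Unitary.

Definition of_kind (k : intertwiner_kind) (H K : preHilbert) (f : H -> K) :
    Prop :=
  match k with
  | Isometric => forall x y, inner (f x) (f y) = inner x y
  | Adjointable => exists g, is_adjoint f g
  | Unitary => exists g, [/\ is_adjoint f g, cancel f g & cancel g f]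
  end.

Record intertwiner (k : intertwiner_kind) (A : starAlgebra) (H K : starRep A) :=
  Intertwiner {
  intw_fun :> H -> K;
  intw_lin : linear intw_fun;
  intw_act : forall a x, intw_fun (rep_act a x) = rep_act a (intw_fun x);
  intw_kind : of_kind k intw_fun
}.

End StarAlgebras.

Record category := Category {
  obj :> Type;
  hom : obj -> obj -> Type;
  idm : forall X, hom X X;
  hcomp : forall X Y Z, hom Y Z -> hom X Y -> hom X Z;
  comp1m : forall X Y (f : hom X Y), hcomp (idm Y) f = f;
  compm1 : forall X Y (f : hom X Y), hcomp f (idm X) = f;
  compA : forall X Y Z T (h : hom Z T) (g : hom Y Z) (f : hom X Y),
    hcomp h (hcomp g f) = hcomp (hcomp h g) f
}.

Record functor (D E : category) := Functor {
  fobj :> D -> E;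
  fmap : forall X Y : D, hom X Y -> hom (fobj X) (fobj Y);
  fmap1 : forall X, fmap (idm X) = idm (fobj X);
  fmapM : forall X Y Z (g : hom Y Z) (f : hom X Y),
    fmap (hcomp g f) = hcomp (fmap g) (fmap f)
}.

Section CategoryTheory.

Definition id_functor (D : category) : functor D D :=
  @Functor D D (fun X => X) (fun X Y f => f)
    (fun X => erefl) (fun X Y Z g f => erefl).

Lemma comp_fmap1 (D E F : category) (T : functor E F) (S : functor D E) X :
  fmap T (fmap S (idm X)) = idm (T (S X)).
Proof. by rewrite !fmap1. Qed.

Lemma comp_fmapM (D E F : category) (T : functor E F) (S : functor D E) X Y Z
  (g : hom Y Z) (f : hom X Y) :
  fmap T (fmap S (hcomp g f)) = hcomp (fmap T (fmap S g)) (fmap T (fmap S f)).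
Proof. by rewrite !fmapM. Qed.

Definition comp_functor (D E F : category) (T : functor E F) (S : functor D E) :
    functor D F :=
  @Functor D F (fun X => T (S X)) (fun X Y f => fmap T (fmap S f))
    (comp_fmap1 T S) (comp_fmapM T S).

Definition is_iso (D : category) (X Y : D) (f : hom X Y) : Prop :=
  exists g : hom Y X, hcomp g f = idm X /\ hcomp f g = idm Y.

Definition naturally_isomorphic (D E : category) (S T : functor D E) : Prop :=
  exists eta : forall X, hom (S X) (T X),
    (forall X Y (f : hom X Y), hcomp (eta Y) (fmap S f) = hcomp (fmap T f) (eta X))
    /\ (forall X, is_iso (eta X)).

Definition equivalence_of_categories (D E : category)
    (S : functor D E) (T : functor E D) : Prop :=
  naturally_isomorphic (comp_functor T S) (id_functor D) /\
  naturally_isomorphic (comp_functor S T) (id_functor E).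

End CategoryTheory.

Section RepresentationCategory.
Context (R : realDomainType) (k : intertwiner_kind) (A : starAlgebra R).

Lemma intw_eq (H K : starRep A) (f g : intertwiner k H K) :
  (forall x, f x = g x) -> f = g.
Proof.
case: f g => [f fl fa fk] [g gl ga gk] /= /funext fg; case: g / fg gl ga gk.
by move=> *; congr Intertwiner; apply: Prop_irrelevance.
Qed.

Lemma of_kind_id (H : preHilbert R) : of_kind k (fun x : H => x).
Proof. by case: k => //=; exists id. Qed.

Lemma of_kind_comp (H K L : preHilbert R) (g : K -> L) (f : H -> K) :
  of_kind k g -> of_kind k f -> of_kind k (fun x => g (f x)).
Proof.
case: k => /=.
- by move=> gi fi x y; rewrite gi fi.
- by move=> [g' gg'] [f' ff']; exists (fun x => f' (g' x)) => x y; rewrite gg' ff'.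
- move=> [g' [gg' g1 g2]] [f' [ff' f1 f2]]; exists (fun x => f' (g' x)); split.
  + by move=> x y; rewrite gg' ff'.
  + by move=> x; rewrite g1 f1.
  + by move=> x; rewrite f2 g2.
Qed.

Definition intw_id (H : starRep A) : intertwiner k H H :=
  @Intertwiner R k A H H (fun x => x) (fun c x y => erefl)
    (fun a x => erefl) (of_kind_id H).

Lemma comp_lin (H K L : starRep A) (g : intertwiner k K L)
  (f : intertwiner k H K) : linear (fun x => g (f x)).
Proof. by move=> c x y; rewrite !intw_lin. Qed.

Lemma comp_act (H K L : starRep A) (g : intertwiner k K L)
  (f : intertwiner k H K) a x : g (f (rep_act a x)) = rep_act a (g (f x)).
Proof. by rewrite !intw_act. Qed.

Definition intw_comp (H K L : starRep A) (g : intertwiner k K L)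
    (f : intertwiner k H K) : intertwiner k H L :=
  Intertwiner (comp_lin g f) (comp_act g f)
    (of_kind_comp (intw_kind g) (intw_kind f)).

Lemma intw_comp1 (H K : starRep A) (f : intertwiner k H K) :
  intw_comp (intw_id K) f = f.
Proof. exact: intw_eq. Qed.
Lemma intw_1comp (H K : starRep A) (f : intertwiner k H K) :
  intw_comp f (intw_id H) = f.
Proof. exact: intw_eq. Qed.
Lemma intw_compA (H K L M : starRep A) (h : intertwiner k L M)
  (g : intertwiner k K L) (f : intertwiner k H K) :
  intw_comp h (intw_comp g f) = intw_comp (intw_comp h g) f.
Proof. exact: intw_eq. Qed.

Definition starRep_category : category :=
  @Category (sndRep A) (fun H K => intertwiner k H K) intw_id
    (fun H K L => @intw_comp H K L) (fun H K => @intw_comp1 H K)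
    (fun H K => @intw_1comp H K) (fun H K L M => @intw_compA H K L M).

End RepresentationCategory.

Section Bimodules.
Context (R : realDomainType).
Local Notation C := (cext R).

Record bimodule (B A : starAlgebra R) := Bimodule {
  bim_mod :> lmodType C;
  lact : B -> bim_mod -> bim_mod;
  ract : bim_mod -> A -> bim_mod;
  lact_linl : forall x, linear (lact^~ x);
  lact_linr : forall b, linear (lact b);
  lactM : forall b b' x, lact (amul b b') x = lact b (lact b' x);
  ract_linl : forall a, linear (ract^~ a);
  ract_linr : forall x, linear (ract x);
  ractM : forall x a a', ract x (amul a a') = ract (ract x a) a';
  lractC : forall b x a, ract (lact b x) a = lact b (ract x a)
}.

Definition nondegenerate_bimodule (B A : starAlgebra R) (X : bimodule B A) : Prop :=
  (forall x : X, cspan (fun y => exists b (z : X), y = lact b z) x) /\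
  (forall x : X, cspan (fun y => exists (z : X) a, y = ract z a) x).

(* Bimodules with a full, positive A-valued inner product: the data needed to
   define the form on the tensor products X (x)_A H. *)
Record rieffelBimodule (B A : starAlgebra R) := RieffelBimodule {
  rief_bim :> bimodule B A;
  rip : rief_bim -> rief_bim -> A;
  rip_lin : forall x, linear (rip x);
  rip_sym : forall x y, rip x y = astar (rip y x);
  rip_ract : forall x y a, rip x (ract y a) = amul (rip x y) a;
  rip_ge0 : forall x, positive_element (rip x x);
  rip_lact : forall b x y, rip x (lact b y) = rip (lact (astar b) x) y;
  rip_full : forall a, cspan (fun a' => exists x y, a' = rip x y) a
}.

(* Equivalence bimodules except for the positivity of the forms on the tensor
   products, which is added in [equivBimodule]. *)
Record preEquivBimodule (B A : starAlgebra R) := PreEquivBimodule {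
  pre_rief :> rieffelBimodule B A;
  lip : pre_rief -> pre_rief -> B;
  lip_lin : forall y, linear (lip^~ y);
  lip_sym : forall x y, lip x y = astar (lip y x);
  lip_lact : forall b x y, lip (lact b x) y = amul b (lip x y);
  lip_ge0 : forall x, positive_element (lip x x);
  lip_ract : forall x y a, lip (ract x a) y = lip x (ract y (astar a));
  lip_full : forall b, cspan (fun b' => exists x y, b' = lip x y) b;
  lip_rip : forall x y z, lact (lip x y) z = ract x (rip y z)
}.

End Bimodules.

Section ConjugateModule.
Context (R : realDomainType).
Local Notation C := (cext R).

Definition conj_mod (V : lmodType C) : Type := V.

HB.instance Definition _ (V : lmodType C) := GRing.Zmodule.on (conj_mod V).

Section Scale.
Context (V : lmodType C).
Implicit Types (c : C) (v : conj_mod V).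

Definition conj_scale c v : conj_mod V := cconj c *: (v : V).

Lemma conj_scaleA a b v : conj_scale a (conj_scale b v) = conj_scale (a * b) v.
Proof. by rewrite /conj_scale scalerA cconjM. Qed.
Lemma conj_scale1 : left_id 1 conj_scale.
Proof. by move=> v; rewrite /conj_scale cconj1 scale1r. Qed.
Lemma conj_scaleDr : right_distributive conj_scale +%R.
Proof. by move=> c u v; rewrite /conj_scale -scalerDr. Qed.
Lemma conj_scaleDl v : {morph conj_scale^~ v : a b / a + b}.
Proof. by move=> a b; rewrite /conj_scale cconjD scalerDl. Qed.

HB.instance Definition _ := GRing.Zmodule_isLmodule.Build C (conj_mod V)
  conj_scaleA conj_scale1 conj_scaleDr conj_scaleDl.

End Scale.
End ConjugateModule.

Section ConjugateBimodule.
Context (R : realDomainType) (B A : starAlgebra R).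
Local Notation C := (cext R).

Section Bimodule.
Context (X : bimodule B A).
Local Notation Xc := (conj_mod X).

Definition conj_lact (a : A) (x : Xc) : Xc := ract (x : X) (astar a).
Definition conj_ract (x : Xc) (b : B) : Xc := lact (astar b) (x : X).

Lemma conj_lact_linl x : linear (conj_lact^~ x).
Proof. by move=> c a b; rewrite /conj_lact astar_antilin ract_linr. Qed.
Lemma conj_lact_linr a : linear (conj_lact a).
Proof. by move=> c x y; apply: (ract_linl (astar a) (cconj c) (x : X) (y : X)). Qed.
Lemma conj_lactM a a' x : conj_lact (amul a a') x = conj_lact a (conj_lact a' x).
Proof. by rewrite /conj_lact astarM ractM. Qed.
Lemma conj_ract_linl b : linear (conj_ract^~ b).
Proof. by move=> c x y; apply: (lact_linr (astar b) (cconj c) (x : X) (y : X)). Qed.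
Lemma conj_ract_linr x : linear (conj_ract x).
Proof. by move=> c a b; rewrite /conj_ract astar_antilin lact_linl. Qed.
Lemma conj_ractM x b b' : conj_ract x (amul b b') = conj_ract (conj_ract x b) b'.
Proof. by rewrite /conj_ract astarM lactM. Qed.
Lemma conj_lractC a x b : conj_ract (conj_lact a x) b = conj_lact a (conj_ract x b).
Proof. by rewrite /conj_ract /conj_lact lractC. Qed.

Definition conj_bimodule : bimodule A B := Bimodule
  conj_lact_linl conj_lact_linr conj_lactM
  conj_ract_linl conj_ract_linr conj_ractM conj_lractC.

End Bimodule.

Section Rieffel.
Context (X : preEquivBimodule B A).
Local Notation Xc := (conj_bimodule X).

Definition conj_rip (x y : Xc) : B := lip (x : X) (y : X).

Lemma conj_rip_lin x : linear (conj_rip x).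
Proof.
move=> c y z; rewrite /conj_rip lip_sym.
rewrite (lip_lin (x : X) (cconj c) (y : X) (z : X)) astar_antilin cconjK.
by rewrite -!lip_sym.
Qed.
Lemma conj_rip_sym x y : conj_rip x y = astar (conj_rip y x).
Proof. exact: lip_sym. Qed.
Lemma conj_rip_ract x y b : conj_rip x (ract y b) = amul (conj_rip x y) b.
Proof.
by rewrite /conj_rip /= /conj_ract [LHS]lip_sym lip_lact astarM astarK -lip_sym.
Qed.
Lemma conj_rip_ge0 x : positive_element (conj_rip x x).
Proof. exact: lip_ge0. Qed.
Lemma conj_rip_lact a x y :
  conj_rip x (lact a y) = conj_rip (lact (astar a) x) y.
Proof. by rewrite /conj_rip /= /conj_lact astarK lip_ract. Qed.
Lemma conj_rip_full b : cspan (fun b' => exists x y, b' = conj_rip x y) b.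
Proof. exact: lip_full. Qed.

Definition conj_rieffel : rieffelBimodule A B := RieffelBimodule
  conj_rip_lin conj_rip_sym conj_rip_ract conj_rip_ge0 conj_rip_lact
  conj_rip_full.

End Rieffel.
End ConjugateBimodule.

Section FreeModule.
Context (R : realDomainType) (K : choiceType).
Local Notation C := (cext R).
Local Notation F := {freeg K / C}.

Lemma freegU_scale (c : C) (x : K) : << c *g x >> = c *: << x >> :> F.
Proof. by apply/eqP/freeg_eqP => y; rewrite coeffZ !coeffU mul1r. Qed.

Context (W : lmodType C).
Implicit Types f g : K -> W.

Lemma fgliftD f (D E : F) : fglift f (D + E) = fglift f D + fglift f E.
Proof.
have add := lift_is_additive f.
have f0 : fglift f 0 = 0 by have := add 0 0; rewrite subr0 subrr.
have fN G : fglift f (- G) = - fglift f G by rewrite -sub0r add f0 sub0r.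
by rewrite -[in LHS](opprK E) add fN opprK.
Qed.

Lemma fglift0 f : fglift f (0 : F) = 0.
Proof. by have := fgliftD f 0 0; rewrite addr0 => /esym/eqP; rewrite -subr_eq0 addrK => /eqP. Qed.

Lemma fglift_sum f I (r : seq I) (E : I -> F) :
  fglift f (\sum_(i <- r) E i) = \sum_(i <- r) fglift f (E i).
Proof. exact: (big_morph _ (fgliftD f) (fglift0 f)). Qed.

Lemma fgliftZ f c (D : F) : fglift f (c *: D) = c *: fglift f D.
Proof.
have -> : c *: D = \sum_(x <- dom D) << c * coeff x D *g x >> by [].
rewrite -[D in RHS]freeg_sumE !fglift_sum scaler_sumr.
by apply: eq_bigr => x _; rewrite !liftU scalerA.
Qed.

Lemma fglift_lin f : linear (fglift f : F -> W).
Proof. by move=> c D E; rewrite fgliftD fgliftZ. Qed.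

Lemma fglift1 f x : fglift f << x >> = f x.
Proof. by rewrite liftU scale1r. Qed.

End FreeModule.

Section Tensor.
Context (R : realDomainType) (B A : starAlgebra R).
Local Notation C := (cext R).
Context (X : bimodule B A) (H : starRep A).
Local Notation F := {freeg (X * H) / C}.

Inductive tensor_rel : F -> Prop :=
| tensor_rel_linl c x y h :
    tensor_rel (<< (c *: x + y, h) >> - (c *: << (x, h) >> + << (y, h) >>))
| tensor_rel_linr c x h h' :
    tensor_rel (<< (x, c *: h + h') >> - (c *: << (x, h) >> + << (x, h') >>))
| tensor_rel_act x a h :
    tensor_rel (<< (ract x a, h) >> - << (x, rep_act a h) >>).

Definition tensor : lmodType C := lquot (span_sub tensor_rel).

Definition tens (x : X) (h : H) : tensor := qpi (span_sub tensor_rel) << (x, h) >>.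

Lemma tens_linl h : linear (tens^~ h).
Proof.
by move=> c x y; rewrite /tens -qpiL; apply/qpiP/span_gen/tensor_rel_linl.
Qed.
Lemma tens_linr x : linear (tens x).
Proof.
by move=> c h h'; rewrite /tens -qpiL; apply/qpiP/span_gen/tensor_rel_linr.
Qed.
Lemma tens_act x a h : tens (ract x a) h = tens x (rep_act a h).
Proof. exact/qpiP/span_gen/tensor_rel_act. Qed.

Lemma tensor_ind (P : tensor -> Prop) :
  P 0 -> (forall c x h t, P t -> P (c *: tens x h + t)) -> forall t, P t.
Proof.
move=> P0 PL t; rewrite -[t]qreprK -[qrepr t]freeg_sumE.
elim: (dom _) => [|[x h] s IH].
  by rewrite big_nil qpi0.
by rewrite big_cons freegU_scale qpiL; apply: PL.
Qed.

Record balanced (W : lmodType C) (f : X -> H -> W) : Prop := Balanced {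
  bal_linl : forall h, linear (f^~ h);
  bal_linr : forall x, linear (f x);
  bal_act : forall x a h, f (ract x a) h = f x (rep_act a h)
}.

(* The linear map [x (x) h |-> f x h]; meaningful only for balanced [f]. *)
Definition tlift (W : lmodType C) (f : X -> H -> W) (t : tensor) : W :=
  fglift (fun p => f p.1 p.2) (qrepr t).

Section Lift.
Context (W : lmodType C) (f : X -> H -> W) (fB : balanced f).

Lemma tlift_pi D : tlift f (qpi _ D) = fglift (fun p => f p.1 p.2) D.
Proof.
rewrite /tlift; set g := fglift _.
have gL : linear g by exact: fglift_lin.
have gB u v : g (u - v) = g u - g v by exact: lift_is_additive.
suff g0 u : cspan tensor_rel u -> g u = 0.
  apply/eqP; rewrite -subr_eq0 -gB g0 //.
  exact: (qrepr_pi (span_sub tensor_rel) D).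
elim/span_ind; first exact: fglift0.
move=> c {}u v ru gv; rewrite gL gv addr0.
have -> : g u = 0; last by rewrite scaler0.
by case: ru => *; rewrite gB ?gL /g !fglift1 /= ?(bal_linl fB) ?(bal_linr fB)
  ?(bal_act fB) subrr.
Qed.

Lemma tlift_lin : linear (tlift f).
Proof.
by move=> c s t; rewrite -[s]qreprK -[t]qreprK -qpiL !tlift_pi fglift_lin.
Qed.

Lemma tlift_tens x h : tlift f (tens x h) = f x h.
Proof. by rewrite tlift_pi fglift1. Qed.

End Lift.

Lemma lin0 (V W : lmodType C) (f : V -> W) : linear f -> f 0 = 0.
Proof. by move=> fL; have := fL (-1) 0 0; rewrite scaler0 addr0 scaleN1r addNr. Qed.

Lemma tensor_ext (W : lmodType C) (f g : tensor -> W) :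
  linear f -> linear g -> (forall x h, f (tens x h) = g (tens x h)) -> f =1 g.
Proof.
move=> fL gL fg; elim/tensor_ind => [|c x h t IH]; first by rewrite !lin0.
by rewrite fL gL fg IH.
Qed.

End Tensor.

Section TensorForm.
Context (R : realDomainType) (B A : starAlgebra R).
Local Notation C := (cext R).
Context (X : rieffelBimodule B A) (H : starRep A).
Local Notation T := (tensor X H).

Definition pure_form (x : X) (h : H) (y : X) (h' : H) : C :=
  inner h (rep_act (rip x y) h').

(* [tform] is the form on the tensor product with
   tform (tens x h) (tens y h') = pure_form x h y h', see [tform_tens];
   the conjugations make it antilinear in its first argument. *)
Definition tform_pure (x : X) (h : H) (s : T) : C :=
  tlift (W := C^o) (pure_form x h) s.

Definition tform (t s : T) : C :=
  cconj (tlift (W := C^o) (fun x h => cconj (tform_pure x h s)) t).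

Lemma pure_form_balanced x h : balanced (W := C^o) (pure_form x h).
Proof.
split.
- by move=> h' c y z; rewrite /pure_form rip_lin rep_linl inner_lin.
- by move=> y c h' h''; rewrite /pure_form rep_linr inner_lin.
- by move=> y a h'; rewrite /pure_form rip_ract rep_mul.
Qed.

Lemma pure_form_sym x h y h' :
  pure_form x h y h' = cconj (pure_form y h' x h).
Proof. by rewrite /pure_form rip_sym -inner_sym rep_star. Qed.

Lemma tform_pure_lin x h : scalar (tform_pure x h).
Proof. exact: (tlift_lin (pure_form_balanced x h)). Qed.

Lemma tform_pure_tens x h y h' :
  tform_pure x h (tens y h') = pure_form x h y h'.
Proof. exact: (tlift_tens (pure_form_balanced x h)). Qed.

Lemma cscale0 (W : lmodType C) (f : W -> C) : scalar f -> f 0 = 0.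
Proof. exact: (@lin0 _ _ C^o). Qed.

Lemma conj_form_balanced s :
  balanced (W := C^o) (fun x h => cconj (tform_pure x h s)).
Proof.
elim/tensor_ind: s => [|c y h' s [Ll Lr La]].
  have E x h : cconj (tform_pure x h 0) = 0.
    by rewrite (cscale0 (tform_pure_lin x h)) cconj0.
  by split=> [h d x z|x d h h'|x a h]; rewrite /= !E ?scaler0 ?addr0.
have E x h : cconj (tform_pure x h (c *: tens y h' + s)) =
    cconj c * pure_form y h' x h + cconj (tform_pure x h s).
  rewrite tform_pure_lin tform_pure_tens cconjD cconjM.
  by rewrite -pure_form_sym.
have [Pl Pr Pa] := pure_form_balanced y h'.
split.
- move=> h d x z; rewrite /= !E (Ll h) [pure_form _ _ _ _](Pl h) /GRing.scale /=.
  by ring.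
- move=> x d h h''; rewrite /= !E (Lr x) [pure_form _ _ _ _](Pr x) /GRing.scale /=.
  by ring.
- by move=> x a h; rewrite !E La Pa.
Qed.

Lemma tform_tensl x h s : tform (tens x h) s = tform_pure x h s.
Proof. by rewrite /tform (tlift_tens (conj_form_balanced s)) cconjK. Qed.

Lemma tform_tens x h y h' :
  tform (tens x h) (tens y h') = inner h (rep_act (rip x y) h').
Proof. by rewrite tform_tensl tform_pure_tens. Qed.

Lemma tform_antilin s c t t' :
  tform (c *: t + t') s = cconj c * tform t s + tform t' s.
Proof. by rewrite /tform (tlift_lin (conj_form_balanced s)) cconjD cconjM. Qed.

Lemma tform0l s : tform 0 s = 0.
Proof.
by rewrite /tform (lin0 (tlift_lin (conj_form_balanced s))) cconj0.
Qed.

Lemma tform_lin t : scalar (tform t).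
Proof.
elim/tensor_ind: t => [|c x h t IH] d s s'; first by rewrite !tform0l mulr0 addr0.
rewrite !tform_antilin !tform_tensl tform_pure_lin IH; ring.
Qed.

Lemma tform_sym t s : tform t s = cconj (tform s t).
Proof.
elim/tensor_ind: t => [|c x h t IH].
  by rewrite tform0l (cscale0 (tform_lin s)) cconj0.
rewrite tform_antilin tform_lin cconjD cconjM IH; congr (_ * _ + _).
elim/tensor_ind: s {IH} => [|d y h' s IH].
  by rewrite tform0l (cscale0 (tform_lin _)) cconj0.
rewrite tform_antilin tform_lin cconjD cconjM IH cconjK !tform_tens.
by congr (_ * _ + _); apply: pure_form_sym.
Qed.

End TensorForm.

Definition tensor_positive (R : realDomainType) (B A : starAlgebra R)
    (X : rieffelBimodule B A) : Prop :=
  forall (H : starRep A) (t : tensor X H), cge0 (tform t t).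

Record equivBimodule (R : realDomainType) (B A : starAlgebra R) :=
  EquivBimodule {
  equiv_pre :> preEquivBimodule B A;
  equiv_P : tensor_positive equiv_pre;
  equiv_Q : tensor_positive (conj_rieffel equiv_pre)
}.

Section SemiHilbert.
Context (R : realDomainType).
Local Notation C := (cext R).

Record semiHilbert := SemiHilbert {
  semi_mod :> lmodType C;
  sip : semi_mod -> semi_mod -> C;
  sip_lin : forall x, scalar (sip x);
  sip_sym : forall x y, sip x y = cconj (sip y x);
  sip_ge0 : forall x, cge0 (sip x x)
}.

Section Reduction.
Context (V : semiHilbert).

Lemma sip_antilin (x : V) c y z :
  sip (c *: y + z) x = cconj c * sip y x + sip z x.
Proof. by rewrite sip_sym sip_lin cconjD cconjM -!sip_sym. Qed.

Lemma sip0r (x : V) : sip x 0 = 0.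
Proof. exact: (cscale0 (sip_lin x)). Qed.

(* Over an ordered ring a null vector of a positive semi-definite form lies in
   its radical, although there is no division. *)
Lemma sip_null (v : V) : sip v v = 0 -> forall u, sip u v = 0.
Proof.
move=> v0 u; set z := sip u v.
suff: Re z ^+ 2 + Im z ^+ 2 = 0.
  move/eqP; rewrite paddr_eq0 ?sqr_ge0 // !sqrf_eq0 => /andP[/eqP r0 /eqP i0].
  exact: cP.
have zE : sip v u = cconj z by rewrite sip_sym.
have [si s0] := sip_ge0 u; set s := Re (sip u u) in s0.
set n := Re z ^+ 2 + Im z ^+ 2.
have n0 : 0 <= n by rewrite addr_ge0 ?sqr_ge0.
have sZr c (x y : V) : sip x (c *: y) = c * sip x y.
  by rewrite -[c *: y]addr0 sip_lin sip0r addr0.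
have sZl c (x y : V) : sip (c *: x) y = cconj c * sip x y.
  by rewrite sip_sym sZr cconjM -sip_sym.
have key (t b : R) : 0 <= b ^+ 2 * s - 2 * t * b * n.
  pose w := (- (t%:C : C) * cconj z) *: v + (b%:C : C) *: u.
  have [_] := sip_ge0 w.
  rewrite /w sip_antilin !sip_lin !sZr sZl.
  rewrite v0 zE -/z.
  rewrite ?sZl !(cReM, cReD, cImM, cImD) /= -/s si.
  move=> le0; apply: (le_trans le0); rewrite le_eqVlt; apply/orP; left.
  apply/eqP; rewrite /n; ring.
have [s_le0|s_gt0] := leP s 0; last first.
  have := key s n; have -> : n ^+ 2 * s - 2 * s * n * n = - (n ^+ 2 * s) by ring.
  rewrite oppr_ge0 pmulr_lle0 // => n2; apply/eqP; rewrite -sqrf_eq0.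
  by rewrite eq_le n2 sqr_ge0.
have {}s0 : s = 0 by apply/eqP; rewrite eq_le s_le0.
have := key 1 1; rewrite s0.
have -> : 1 ^+ 2 * 0 - 2 * 1 * 1 * n = - (2 * n) by ring.
by rewrite oppr_ge0 pmulr_rle0 // => n1; apply/eqP; rewrite eq_le n1.
Qed.

Lemma radical0 : forall u : V, sip u 0 = 0.
Proof. exact: sip0r. Qed.
Lemma radicalL c (v w : V) : (forall u : V, sip u v = 0) -> (forall u : V, sip u w = 0) ->
  forall u : V, sip u (c *: v + w) = 0.
Proof. by move=> v0 w0 u; rewrite sip_lin v0 w0 mulr0 addr0. Qed.

Definition radical : submodule V :=
  Submodule (sub_pred := fun v : V => forall u : V, sip u v = 0) radical0 radicalL.

Local Notation Q := (lquot radical).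
Local Notation qp := (qpi radical).

Definition qip (s t : Q) : C := sip (qrepr s) (qrepr t).

Lemma radical_l (v u : V) : radical v -> sip v u = 0.
Proof. by move=> rv; rewrite sip_sym rv cconj0. Qed.

Lemma qip_pi (u v : V) : qip (qp u) (qp v) = sip u v.
Proof.
have sB (x y z : V) : sip x (y - z) = sip x y - sip x z.
  by rewrite addrC -scaleN1r sip_lin mulN1r addrC.
have rB (x y z : V) : radical (y - z) -> sip x y = sip x z.
  by move=> ryz; apply/eqP; rewrite -subr_eq0 -sB ryz.
rewrite /qip (rB _ _ v) ?(sip_sym _ v) ?(rB _ _ u) -?sip_sym //;
  exact: (qrepr_pi radical).
Qed.

Lemma qip_lin s : scalar (qip s).
Proof.
move=> c t u; rewrite -[s]qreprK -[t]qreprK -[u]qreprK -qpiL !qip_pi.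
exact: sip_lin.
Qed.
Lemma qip_sym s t : qip s t = cconj (qip t s).
Proof. by rewrite /qip sip_sym. Qed.
Lemma qip_ge0 s : cge0 (qip s s).
Proof. exact: sip_ge0. Qed.
Lemma qip_def s : qip s s = 0 -> s = 0.
Proof.
move=> /sip_null s0; rewrite -[s]qreprK -(qpi0 radical).
by apply/qpiP => u; rewrite subr0.
Qed.

Definition reduction : preHilbert R :=
  PreHilbert qip_lin qip_sym qip_ge0 qip_def.

End Reduction.

(* The map induced by [f] on the reductions; meaningful only if [f] is linear
   and preserves null vectors. *)
Definition rmap (V W : semiHilbert) (f : V -> W) (s : reduction V) :
    reduction W :=
  qpi (radical W) (f (qrepr s)).

Definition preserves_null (V W : semiHilbert) (f : V -> W) : Prop :=
  forall v, sip v v = 0 -> sip (f v) (f v) = 0.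

Section ReductionMap.
Context (V W : semiHilbert).

Lemma adjoint_null (f : V -> W) (g : W -> V) :
  (forall u v, sip (f u) v = sip u (g v)) -> preserves_null f.
Proof. by move=> fg v v0; rewrite fg sip_sym (sip_null v0) cconj0. Qed.

Lemma isometric_null (f : V -> W) :
  (forall u v, sip (f u) (f v) = sip u v) -> preserves_null f.
Proof. by move=> fi v; rewrite fi. Qed.

Context (f : V -> W) (fL : linear f) (fN : preserves_null f).

Lemma rmap_pi v : rmap f (qpi (radical V) v) = qpi (radical W) (f v).
Proof.
have fB u w : f (u - w) = f u - f w.
  by rewrite addrC -scaleN1r fL scaleN1r addrC.
apply/qpiP => u; rewrite -fB; apply: sip_null; apply: fN.
exact: (qrepr_pi (radical V)).
Qed.

Lemma rmap_lin : linear (rmap f).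
Proof.
by move=> c s t; rewrite -[s]qreprK -[t]qreprK -qpiL !rmap_pi fL qpiL.
Qed.

End ReductionMap.
End SemiHilbert.

Section Induction.
Context (R : realDomainType) (B A : starAlgebra R).
Local Notation C := (cext R).
Context (X : rieffelBimodule B A).

Lemma tform_adj (H K : starRep A) (f : tensor X H -> tensor X K)
    (g : tensor X K -> tensor X H) :
  linear f -> linear g ->
  (forall x h y h',
    tform (f (tens x h)) (tens y h') = tform (tens x h) (g (tens y h'))) ->
  forall t s, tform (f t) s = tform t (g s).
Proof.
move=> fL gL fg; elim/tensor_ind => [|c x h t IH] s.
  by rewrite (lin0 fL) !tform0l.
rewrite fL !tform_antilin IH; congr (_ * _ + _).
elim/tensor_ind: s {IH} => [|d y h' s IH].
  by rewrite (lin0 gL) !(cscale0 (tform_lin _)).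
by rewrite gL !tform_lin IH fg.
Qed.

Lemma tform_iso (H K : starRep A) (f : tensor X H -> tensor X K) :
  linear f ->
  (forall x h y h',
    tform (f (tens x h)) (f (tens y h')) = tform (tens x h) (tens y h')) ->
  forall t s, tform (f t) (f s) = tform t s.
Proof.
move=> fL ff; elim/tensor_ind => [|c x h t IH] s.
  by rewrite (lin0 fL) !tform0l.
rewrite fL !tform_antilin IH; congr (_ * _ + _).
elim/tensor_ind: s {IH} => [|d y h' s IH].
  by rewrite (lin0 fL) !(cscale0 (tform_lin _)).
by rewrite fL !tform_lin IH ff.
Qed.

Section Action.
Context (H : starRep A).

Definition tact (b : B) : tensor X H -> tensor X H :=
  tlift (fun x h => tens (lact b x) h).

Lemma tact_balanced b : balanced (fun (x : X) (h : H) => tens (lact b x) h).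
Proof.
split=> [h c x y|x c h h'|x a h] /=.
- by rewrite lact_linr tens_linl.
- by rewrite tens_linr.
- by rewrite -lractC tens_act.
Qed.

Lemma tact_lin b : linear (tact b).
Proof. exact: tlift_lin (tact_balanced b). Qed.

Lemma tact_tens b x h : tact b (tens x h) = tens (lact b x) h.
Proof. exact: (tlift_tens (tact_balanced b)). Qed.

Lemma tact_linl c b b' t : tact (c *: b + b') t = c *: tact b t + tact b' t.
Proof.
elim/tensor_ind: t => [|d x h t IH].
  by rewrite !(lin0 (tact_lin _)) scaler0 addr0.
rewrite !tact_lin IH !tact_tens lact_linl tens_linl.
by rewrite !scalerDr !scalerA (mulrC d) addrACA.
Qed.

Lemma tact_mul b b' t : tact (amul b b') t = tact b (tact b' t).
Proof.
elim/tensor_ind: t => [|d x h t IH].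
  by rewrite !(lin0 (tact_lin _)).
by rewrite !tact_lin IH !tact_tens lactM.
Qed.

Lemma tact_adj b t s : tform (tact b t) s = tform t (tact (astar b) s).
Proof.
apply: tform_adj; [exact: tact_lin | exact: tact_lin | move=> x h y h'].
by rewrite !tact_tens !tform_tens rip_lact astarK.
Qed.

End Action.

Section Map.
Context (H K : starRep A).

Definition tmap (U : H -> K) : tensor X H -> tensor X K :=
  tlift (fun x h => tens x (U h)).

Context (U : H -> K) (UL : linear U)
  (UA : forall a h, U (rep_act a h) = rep_act a (U h)).

Lemma tmap_balanced : balanced (fun (x : X) (h : H) => tens x (U h)).
Proof.
split=> [h c x y|x c h h'|x a h] /=.
- by rewrite tens_linl.
- by rewrite UL tens_linr.
- by rewrite tens_act UA.
Qed.

Lemma tmap_lin : linear (tmap U).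
Proof. exact: tlift_lin tmap_balanced. Qed.

Lemma tmap_tens x h : tmap U (tens x h) = tens x (U h).
Proof. exact: (tlift_tens tmap_balanced). Qed.

Lemma tmap_act b t : tmap U (tact b t) = tact b (tmap U t).
Proof.
elim/tensor_ind: t => [|d x h t IH].
  by rewrite !(lin0 (tact_lin _)) !(lin0 tmap_lin) (lin0 (tact_lin _)).
by rewrite tact_lin !tmap_lin tact_lin IH tact_tens !tmap_tens tact_tens.
Qed.

Lemma tmap_iso :
  (forall h h', inner (U h) (U h') = inner h h') ->
  forall t s, tform (tmap U t) (tmap U s) = tform t s.
Proof.
move=> Ui; apply: (tform_iso tmap_lin) => x h y h'.
by rewrite !tmap_tens !tform_tens -UA Ui.
Qed.

End Map.

Section Adjoint.
Context (H K : starRep A) (U : H -> K) (U' : K -> H) (Uadj : is_adjoint U U').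

Lemma inner_eq (L : preHilbert R) (h h' : L) :
  (forall l, inner l h = inner l h') -> h = h'.
Proof.
move=> hh; apply/eqP; rewrite -subr_eq0; apply/eqP/inner_def.
by rewrite addrC -scaleN1r inner_lin hh mulN1r addNr.
Qed.

Lemma adjoint_lin : linear U'.
Proof.
by move=> c x y; apply: inner_eq => l; rewrite -Uadj !inner_lin -!Uadj.
Qed.

Lemma adjoint_act :
  (forall a h, U (rep_act a h) = rep_act a (U h)) ->
  forall a k, U' (rep_act a k) = rep_act a (U' k).
Proof.
move=> UA a k; apply: inner_eq => l.
by rewrite -Uadj -[a in LHS]astarK -rep_star -UA Uadj rep_star astarK.
Qed.

Lemma tmap_adj : linear U ->
  (forall a h, U (rep_act a h) = rep_act a (U h)) ->
  forall t s, tform (tmap U t) s = tform t (tmap U' s).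
Proof.
move=> UL UA; have VL := adjoint_lin; have VA := adjoint_act UA.
apply: tform_adj; [exact: tmap_lin | exact: tmap_lin | move=> x h y h'].
by rewrite !tmap_tens // !tform_tens Uadj VA.
Qed.

End Adjoint.

Context (XP : tensor_positive X).

Definition tensor_semi (H : starRep A) : semiHilbert R :=
  SemiHilbert (@tform_lin R B A X H) (@tform_sym R B A X H) (@XP H).

Section InducedRep.
Context (H : starRep A).

(* With [induced_vec t] the class of t, the induced representation satisfies
   b [x (x) h] = [(b x) (x) h] ([induced_act_vec], [tact_tens]) and an
   intertwiner U induces [x (x) h] |-> [x (x) U h] ([induced_map_vec],
   [tmap_tens]). *)
Definition induced_space : preHilbert R := reduction (tensor_semi H).

Definition induced_act (b : B) : induced_space -> induced_space :=
  @rmap R (tensor_semi H) (tensor_semi H) (tact b).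

Lemma tact_null b :
  @preserves_null R (tensor_semi H) (tensor_semi H) (tact b).
Proof.
apply: (@adjoint_null R (tensor_semi H) (tensor_semi H) _ (tact (astar b))).
exact: tact_adj.
Qed.

Definition induced_vec (t : tensor X H) : induced_space :=
  qpi (radical (tensor_semi H)) t.

Lemma induced_vec_surj s : induced_vec (qrepr s) = s.
Proof. exact: qreprK. Qed.

Lemma induced_vecL c t s :
  induced_vec (c *: t + s) = c *: induced_vec t + induced_vec s.
Proof. exact: (qpiL (radical (tensor_semi H))). Qed.

Lemma induced_vec_inner t s :
  inner (induced_vec t) (induced_vec s) = tform t s.
Proof. exact: (@qip_pi R (tensor_semi H)). Qed.

Lemma induced_act_vec b t : induced_act b (induced_vec t) = induced_vec (tact b t).
Proof. exact: (@rmap_pi R (tensor_semi H) (tensor_semi H) _ (@tact_lin H b) (@tact_null b)). Qed.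

Lemma induced_linr b : linear (induced_act b).
Proof. exact: (@rmap_lin R (tensor_semi H) (tensor_semi H) _ (@tact_lin H b) (@tact_null b)). Qed.

Lemma induced_linl s : linear (induced_act^~ s).
Proof.
move=> c b b'; rewrite -[s]induced_vec_surj !induced_act_vec tact_linl.
exact: induced_vecL.
Qed.

Lemma induced_mul b b' s :
  induced_act (amul b b') s = induced_act b (induced_act b' s).
Proof. by rewrite -[s]induced_vec_surj !induced_act_vec tact_mul. Qed.

Lemma induced_star b : is_adjoint (induced_act b) (induced_act (astar b)).
Proof.
move=> s t; rewrite -[s]induced_vec_surj -[t]induced_vec_surj !induced_act_vec.
by rewrite !induced_vec_inner tact_adj.
Qed.

Definition induced_rep : starRep B :=
  StarRep induced_linr induced_linl induced_mul induced_star.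

Lemma induced_nondeg :
  (forall x : X, cspan (fun y => exists b (z : X), y = lact b z) x) ->
  strongly_nondegenerate induced_rep.
Proof.
move=> Xnd s; rewrite -[s]induced_vec_surj; move: (qrepr s : tensor X H).
elim/tensor_ind => [|c x h t IH].
  by rewrite /induced_vec qpi0; apply: span0.
rewrite induced_vecL; apply: spanL => //.
elim/span_ind: x / (Xnd x) => [|d _ x [b [y ->]] IHx].
  have -> : tens (0 : X) h = 0 by apply: (lin0 (tens_linl h)).
  by rewrite /induced_vec qpi0; apply: span0.
rewrite tens_linl induced_vecL; apply: spanL => //; apply: span_gen.
by exists b, (induced_vec (tens y h)); rewrite -tact_tens -induced_act_vec.
Qed.

End InducedRep.

Definition induced_map (H K : starRep A) (U : H -> K) :
    induced_rep H -> induced_rep K :=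
  @rmap R (tensor_semi H) (tensor_semi K) (tmap U).

Section InducedMap.
Context (k : intertwiner_kind) (H K : starRep A) (U : H -> K).
Context (UL : linear U) (UA : forall a h, U (rep_act a h) = rep_act a (U h)).

Lemma tmap_adj_null (V : K -> H) : is_adjoint U V ->
  @preserves_null R (tensor_semi H) (tensor_semi K) (tmap U).
Proof.
move=> UV; apply: (@adjoint_null R (tensor_semi H) (tensor_semi K) _ (tmap V)).
exact: (tmap_adj UV UL UA).
Qed.

Lemma tmap_null : of_kind k U ->
  @preserves_null R (tensor_semi H) (tensor_semi K) (tmap U).
Proof.
case: k => /= [Ui|[V]|[V [UV _ _]]].
- apply: (@isometric_null R (tensor_semi H) (tensor_semi K)).
  exact: (tmap_iso UL UA Ui).
- exact: tmap_adj_null.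
- exact: (tmap_adj_null UV).
Qed.

Context (UN : @preserves_null R (tensor_semi H) (tensor_semi K) (tmap U)).

Lemma induced_map_vec t :
  induced_map U (induced_vec t) = induced_vec (tmap U t).
Proof.
exact: (@rmap_pi R (tensor_semi H) (tensor_semi K) _ (tmap_lin UL UA) UN).
Qed.

Lemma induced_map_lin : linear (induced_map U).
Proof.
exact: (@rmap_lin R (tensor_semi H) (tensor_semi K) _ (tmap_lin UL UA) UN).
Qed.

Lemma induced_map_act b s :
  induced_map U (rep_act b s) = rep_act b (induced_map U s).
Proof.
rewrite -[s]induced_vec_surj [rep_act b _]induced_act_vec !induced_map_vec.
by rewrite [rep_act b _]induced_act_vec tmap_act.
Qed.

Lemma induced_map_iso :
  (forall x y, inner (U x) (U y) = inner x y) ->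
  forall s t, inner (induced_map U s) (induced_map U t) = inner s t.
Proof.
move=> Ui s t; rewrite -[s]induced_vec_surj -[t]induced_vec_surj.
by rewrite !induced_map_vec !induced_vec_inner tmap_iso.
Qed.

End InducedMap.

Lemma is_adjoint_sym (H K : preHilbert R) (U : H -> K) (V : K -> H) :
  is_adjoint U V -> is_adjoint V U.
Proof. by move=> UV x y; rewrite inner_sym -UV -inner_sym. Qed.

Lemma induced_map_adj (H K : starRep A) (U : H -> K) (V : K -> H) :
  linear U -> (forall a h, U (rep_act a h) = rep_act a (U h)) ->
  is_adjoint U V -> is_adjoint (induced_map U) (induced_map V).
Proof.
move=> UL UA UV s t; rewrite -[s]induced_vec_surj -[t]induced_vec_surj.
have VL := adjoint_lin UV; have VA := adjoint_act UV UA.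
rewrite (induced_map_vec UL UA (tmap_adj_null UL UA UV)).
rewrite (induced_map_vec VL VA (tmap_adj_null VL VA (is_adjoint_sym UV))).
by rewrite !induced_vec_inner (tmap_adj UV).
Qed.

Lemma induced_map_comp (H K L : starRep A) (V : K -> L) (U : H -> K) :
  linear U -> (forall a h, U (rep_act a h) = rep_act a (U h)) ->
  linear V -> (forall a h, V (rep_act a h) = rep_act a (V h)) ->
  @preserves_null R (tensor_semi H) (tensor_semi K) (tmap U) ->
  @preserves_null R (tensor_semi K) (tensor_semi L) (tmap V) ->
  @preserves_null R (tensor_semi H) (tensor_semi L) (tmap (fun h => V (U h))) ->
  forall s, induced_map (fun h => V (U h)) s = induced_map V (induced_map U s).
Proof.
move=> UL UA VL VA UN VN VUN s; rewrite -[s]induced_vec_surj.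
have VUL : linear (fun h => V (U h)) by move=> c h h'; rewrite UL VL.
have VUA a h : V (U (rep_act a h)) = rep_act a (V (U h)) by rewrite UA VA.
rewrite !induced_map_vec //; congr induced_vec.
elim/tensor_ind: (qrepr s : tensor X H) => [|c x h t IH].
  by rewrite !(lin0 (tmap_lin _ _)).
by rewrite !tmap_lin // IH !tmap_tens.
Qed.

Lemma tmap_id (H : starRep A) (t : tensor X H) : tmap (fun h : H => h) t = t.
Proof.
elim/tensor_ind: t => [|c x h t IH]; first by rewrite (lin0 (tmap_lin _ _)).
by rewrite tmap_lin // tmap_tens // IH.
Qed.

Lemma induced_map_id (H : starRep A) s : induced_map (fun h : H => h) s = s.
Proof.
rewrite -[s]induced_vec_surj induced_map_vec ?tmap_id // => t t0.
by rewrite /= !tmap_id.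
Qed.

Lemma induced_map_cancel (H K : starRep A) (U : H -> K) (V : K -> H) :
  linear U -> (forall a h, U (rep_act a h) = rep_act a (U h)) ->
  is_adjoint U V -> cancel U V -> cancel (induced_map U) (induced_map V).
Proof.
move=> UL UA UV UK s.
have VL := adjoint_lin UV; have VA := adjoint_act UV UA.
have E : (fun h => V (U h)) = (fun h => h) by apply: funext.
have UN := tmap_adj_null UL UA UV.
have VN := tmap_adj_null VL VA (is_adjoint_sym UV).
rewrite -(induced_map_comp UL UA VL VA UN VN) E ?induced_map_id // => t t0.
by rewrite /= !tmap_id.
Qed.

Section Functor.
Context (k : intertwiner_kind).
Context (Xnd : forall x : X, cspan (fun y => exists b (z : X), y = lact b z) x).

Section Hom.
Context (H K : starRep A) (U : intertwiner k H K).

Lemma intw_null : @preserves_null R (tensor_semi H) (tensor_semi K) (tmap U).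
Proof. exact: (tmap_null (intw_lin U) (intw_act U) (intw_kind U)). Qed.

Lemma induced_kind : of_kind k (induced_map U).
Proof.
have UL := intw_lin U; have UA := intw_act U; have UN := intw_null.
move: (intw_fun U) (intw_kind U) UL UA UN => f.
case: k => /= [fi|[V fV]|[V [fV fK Vf]]] UL UA UN.
- exact: induced_map_iso.
- by exists (induced_map V); apply: induced_map_adj.
- have VL := adjoint_lin fV; have VA := adjoint_act fV UA.
  exists (induced_map V); split; first exact: induced_map_adj.
  + exact: induced_map_cancel.
  + by apply: induced_map_cancel => //; apply: is_adjoint_sym.
Qed.

Definition induced_hom : intertwiner k (induced_rep H) (induced_rep K) :=
  Intertwiner (induced_map_lin (intw_lin U) (intw_act U) intw_null)
    (induced_map_act (intw_lin U) (intw_act U) intw_null) induced_kind.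

End Hom.

Lemma induced_hom1 (H : starRep A) :
  induced_hom (intw_id k H) = intw_id k (induced_rep H).
Proof. by apply: intw_eq => s; apply: induced_map_id. Qed.

Lemma induced_homM (H K L : starRep A) (V : intertwiner k K L)
  (U : intertwiner k H K) :
  induced_hom (intw_comp V U) = intw_comp (induced_hom V) (induced_hom U).
Proof.
apply: intw_eq => s.
exact: (induced_map_comp (intw_lin U) (intw_act U) (intw_lin V) (intw_act V)
  (intw_null U) (intw_null V) (intw_null (intw_comp V U)) s).
Qed.

Definition induced_sndRep (H : sndRep A) : sndRep B :=
  SndRep (induced_nondeg (H := H) Xnd).

Definition rieffel_induction :
    functor (starRep_category k A) (starRep_category k B) :=
  @Functor (starRep_category k A) (starRep_category k B)
    induced_sndRep (fun H K U => induced_hom U)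
    (fun H => induced_hom1 H) (fun H K L V U => induced_homM V U).

End Functor.
End Induction.

Section Functors.
Context (R : realDomainType) (B A : starAlgebra R) (k : intertwiner_kind).
Context (X : equivBimodule B A) (Xnd : nondegenerate_bimodule X).

Lemma conj_nondeg (x : conj_bimodule X) :
  cspan (fun y => exists a (z : conj_bimodule X), y = lact a z) x.
Proof.
elim/span_ind: x / (Xnd.2 (x : X)) => [|c _ x [z [a ->]] IH].
  exact: (@span0 R (conj_bimodule X)).
rewrite -[c]cconjK; apply: (@spanL R (conj_bimodule X)) => //.
apply: span_gen; exists (astar a), (z : X).
by rewrite /= /conj_lact astarK.
Qed.

Definition rieffel_functor :
    functor (starRep_category k A) (starRep_category k B) :=
  rieffel_induction (@equiv_P R B A X) k Xnd.1.

Definition conj_rieffel_functor :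
    functor (starRep_category k B) (starRep_category k A) :=
  rieffel_induction (@equiv_Q R B A X) k conj_nondeg.

End Functors.

(* Main.v *)
(* Evaluation [y (x) [x (x) h]] |-> <y, x>_A h is isometric, because
   <x, _B<y, y'> x'>_A = <y, x>_A^* <y', x'>_A by E3, and it is surjective on
   strongly non-degenerate representations, because the values <y, x>_A span A;
   hence it is a natural unitary.  The second composite is not an instance of the
   first, since the conjugate of the conjugate of X is not convertible to X; both
   are instances of the same argument for an abstract pairing of Y with X. *)
Require Import Defs.
From mathcomp Require Import all_boot all_order all_algebra.
From mathcomp Require Import boolp.

Set Implicit Arguments.
Unset Strict Implicit.
Unset Printing Implicit Defensive.

Import GRing.Theory.

Local Open Scope ring_scope.

(** * Isometries, unitaries and maps out of the reduction of a semi-definite space *)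

Section PreHilbertMaps.
Context (R : realDomainType).
Local Notation C := (cext R).

Lemma inner_antilin (H : preHilbert R) (c : C) (x y z : H) :
  inner (c *: x + y) z = cconj c * inner x z + inner y z.
Proof. by rewrite inner_sym inner_lin cconjD cconjM -!inner_sym. Qed.

Lemma inner0l (H : preHilbert R) (x : H) : inner 0 x = 0.
Proof. by rewrite inner_sym (cscale0 (inner_lin x)) cconj0. Qed.

Lemma inner0r (H : preHilbert R) (x : H) : inner x 0 = 0.
Proof. exact: cscale0 (inner_lin x). Qed.

Lemma linB (V W : lmodType C) (f : V -> W) :
  linear f -> forall u v, f (u - v) = f u - f v.
Proof. by move=> fL u v; rewrite addrC -scaleN1r fL scaleN1r addrC. Qed.

Lemma isometry_inj (H K : preHilbert R) (f : H -> K) :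
  linear f -> (forall x y, inner (f x) (f y) = inner x y) -> injective f.
Proof.
move=> fL fi x y fxy; apply/eqP; rewrite -subr_eq0; apply/eqP/inner_def.
by rewrite -fi (linB fL) fxy subrr inner0l.
Qed.

(** A unitary is a morphism for each of the three choices of intertwiners, so one construction
    serves every [k]. *)
Lemma of_kind_unitary (k : intertwiner_kind) (H K : preHilbert R)
    (f : H -> K) (g : K -> H) :
  is_adjoint f g -> cancel f g -> cancel g f -> of_kind k f.
Proof.
move=> fg fK gK; case: k => /=; [|by exists g|by exists g].
by move=> x y; rewrite fg fK.
Qed.

Section ReductionLift.
Context (V : semiHilbert R) (K : preHilbert R) (f : V -> K).
Context (fL : linear f) (fN : forall v, sip v v = 0 -> f v = 0).

(** Evaluating on a chosen representative is harmless because [f] kills null vectors. *)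
Definition reduction_lift (s : reduction V) : K := f (qrepr s).

Lemma reduction_lift_pi v : reduction_lift (qpi (radical V) v) = f v.
Proof.
apply/eqP; rewrite -subr_eq0 -(linB fL); apply/eqP/fN.
(* The representative differs from [v] by an element of the radical, which is in particular a null
   vector. *)
exact: (qrepr_pi (radical V)).
Qed.

Lemma reduction_lift_lin : linear reduction_lift.
Proof.
move=> c s t; rewrite -[s]qreprK -[t]qreprK -qpiL !reduction_lift_pi.
exact: fL.
Qed.

End ReductionLift.
End PreHilbertMaps.

(** * Elementary tensors as generators of the induced space *)

Section InducedSpace.
Context (R : realDomainType) (B A : starAlgebra R).
Context (X : rieffelBimodule B A) (XP : tensor_positive X) (H : starRep A).

Lemma induced_ind (P : induced_space XP H -> Prop) :
  P 0 -> (forall c x h s, P s -> P (c *: induced_vec XP (tens x h) + s)) ->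
  forall s, P s.
Proof.
move=> P0 PL s; rewrite -[s]induced_vec_surj.
elim/tensor_ind: (qrepr s : tensor X H) => [|c x h t IH].
  by rewrite /induced_vec qpi0.
by rewrite induced_vecL; apply: PL.
Qed.

Lemma induced_hom_tens (k : intertwiner_kind) (K : starRep A)
    (U : intertwiner k H K) x h :
  induced_hom XP U (induced_vec XP (tens x h)) = induced_vec XP (tens x (U h)).
Proof.
have UL := intw_lin U; have UA := intw_act U.
by rewrite /= (induced_map_vec UL UA (intw_null U)) (tmap_tens UL UA).
Qed.

End InducedSpace.

(** * Evaluation of the double induction for an abstract pairing *)

Section Pairing.
Context (R : realDomainType) (B A : starAlgebra R).
Local Notation C := (cext R).

(** [pair_ract] and [pair_balanced] let evaluation descend to the tensor products over [A] and [B];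
    [pair_rip] carries the content of E3 and makes it isometric; [pair_full] makes it surjective. *)
Record rieffel_pairing (X : rieffelBimodule B A) (Y : rieffelBimodule A B)
    (p : Y -> X -> A) : Prop := RieffelPairing {
  pair_linl : forall x, linear (p^~ x);
  pair_linr : forall y, linear (p y);
  pair_lact : forall a y x, p (lact a y) x = amul a (p y x);
  pair_ract : forall y x a, p y (ract x a) = amul (p y x) a;
  pair_balanced : forall y b x, p (ract y b) x = p y (lact b x);
  pair_rip : forall y x y' x',
    rip x (lact (rip y y') x') = amul (astar (p y x)) (p y' x');
  pair_full : forall a, cspan (fun a' => exists y x, a' = p y x) a
}.

Context (X : rieffelBimodule B A) (Y : rieffelBimodule A B) (p : Y -> X -> A).
Context (pP : rieffel_pairing p).
Context (XP : tensor_positive X) (YP : tensor_positive Y).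

Section Evaluation.
Context (H : starRep A).
Local Notation XH := (induced_rep XP H).
Local Notation YXH := (induced_rep YP XH).

Lemma peval_balanced y :
  balanced (fun (x : X) (h : H) => rep_act (p y x) h).
Proof.
split=> [h c x x'|x c h h'|x a h] /=.
- by rewrite (pair_linr pP) rep_linl.
- by rewrite rep_linr.
- by rewrite (pair_ract pP) rep_mul.
Qed.

Definition peval_tensor (y : Y) : tensor X H -> H :=
  tlift (fun x h => rep_act (p y x) h).

Lemma peval_tensor_lin y : linear (peval_tensor y).
Proof. exact: tlift_lin (peval_balanced y). Qed.

Lemma peval_tensor_tens y x h : peval_tensor y (tens x h) = rep_act (p y x) h.
Proof. exact: (tlift_tens (peval_balanced y)). Qed.

(** Both sides are antilinear in [t] and linear in [s], which leaves the case of elementary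
    tensors. *)
Lemma peval_tensor_inner y y' t s :
  inner (peval_tensor y t) (peval_tensor y' s) =
  tform t (tact (rip y y') s).
Proof.
elim/tensor_ind: t => [|c x h t IH].
  by rewrite (lin0 (peval_tensor_lin y)) inner0l tform0l.
rewrite peval_tensor_lin inner_antilin tform_antilin IH; congr (_ * _ + _).
elim/tensor_ind: s {IH} => [|d x' h' s IH].
  rewrite (lin0 (peval_tensor_lin y')) inner0r (lin0 (tact_lin _)).
  by rewrite (cscale0 (tform_lin _)).
rewrite peval_tensor_lin inner_lin tact_lin tform_lin IH; congr (_ * _ + _).
(* [pair_rip] factors the inner product as [astar (p y x)] times [p y' x']; the adjoint then moves
   the first factor across. *)
rewrite !peval_tensor_tens tact_tens tform_tens (pair_rip pP) rep_mul.
exact: rep_star.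
Qed.

(** The squared norm of the value is the form of [t] with another vector, and a null vector lies in
    the radical. *)
Lemma peval_tensor_null y (t : tensor_semi XP H) :
  sip t t = 0 -> peval_tensor y t = 0.
Proof.
move=> t0; apply: inner_def; rewrite peval_tensor_inner.
exact: (radical_l _ (sip_null t0)).
Qed.

Definition peval_vec (y : Y) : XH -> H :=
  @reduction_lift R (tensor_semi XP H) H (peval_tensor y).

Lemma peval_vec_lin y : linear (peval_vec y).
Proof.
exact: (@reduction_lift_lin R (tensor_semi XP H) H _ (peval_tensor_lin y)
  (@peval_tensor_null y)).
Qed.

Lemma peval_vec_pi y t : peval_vec y (induced_vec XP t) = peval_tensor y t.
Proof.
exact: (@reduction_lift_pi R (tensor_semi XP H) H _ (peval_tensor_lin y)
  (@peval_tensor_null y)).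
Qed.

Lemma peval_vec_tens y x h :
  peval_vec y (induced_vec XP (tens x h)) = rep_act (p y x) h.
Proof. by rewrite peval_vec_pi peval_tensor_tens. Qed.

(** The right-hand side is the form of the outer tensor product at [tens y s] and [tens y' s']. *)
Lemma peval_vec_inner y y' s s' :
  inner (peval_vec y s) (peval_vec y' s') = inner s (rep_act (rip y y') s').
Proof.
rewrite -[s]induced_vec_surj -[s']induced_vec_surj !peval_vec_pi.
by rewrite peval_tensor_inner [rep_act _ _]induced_act_vec induced_vec_inner.
Qed.

Lemma peval_vec_lact a y s : peval_vec (lact a y) s = rep_act a (peval_vec y s).
Proof.
elim/induced_ind: s => [|c x h s IH].
  by rewrite !(lin0 (peval_vec_lin _)) (lin0 (rep_linr a)).
by rewrite !peval_vec_lin IH rep_linr !peval_vec_tens (pair_lact pP) rep_mul.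
Qed.

Lemma peval_vec_balanced : balanced peval_vec.
Proof.
split=> [s c y y'|y|y b s]; last 1 first.
- elim/induced_ind: s => [|c x h s IH].
    by rewrite (lin0 (rep_linr b)) !(lin0 (peval_vec_lin _)).
  rewrite rep_linr !peval_vec_lin IH; congr (_ *: _ + _).
  rewrite [rep_act b _]induced_act_vec tact_tens !peval_vec_tens.
  by rewrite (pair_balanced pP).
- elim/induced_ind: s => [|d x h s IH].
    by rewrite !(lin0 (peval_vec_lin _)) scaler0 addr0.
  rewrite !peval_vec_lin IH !peval_vec_tens (pair_linl pP) rep_linl.
  by rewrite !scalerDr !scalerA (mulrC d) addrACA.
- exact: peval_vec_lin.
Qed.

Definition eval_tensor : tensor Y XH -> H := tlift peval_vec.

Lemma eval_tensor_lin : linear eval_tensor.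
Proof. exact: tlift_lin peval_vec_balanced. Qed.

Lemma eval_tensor_tens y s : eval_tensor (tens y s) = peval_vec y s.
Proof. exact: (tlift_tens peval_vec_balanced). Qed.

Lemma eval_tensor_inner t s :
  inner (eval_tensor t) (eval_tensor s) = tform t s.
Proof.
elim/tensor_ind: t => [|c y u t IH].
  by rewrite (lin0 eval_tensor_lin) inner0l tform0l.
rewrite eval_tensor_lin inner_antilin tform_antilin IH; congr (_ * _ + _).
elim/tensor_ind: s {IH} => [|d y' u' s IH].
  by rewrite (lin0 eval_tensor_lin) inner0r (cscale0 (tform_lin _)).
rewrite eval_tensor_lin inner_lin tform_lin IH; congr (_ * _ + _).
by rewrite !eval_tensor_tens tform_tens peval_vec_inner.
Qed.

Lemma eval_tensor_null (t : tensor_semi YP XH) : sip t t = 0 -> eval_tensor t = 0.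
Proof. by move=> t0; apply: inner_def; rewrite eval_tensor_inner. Qed.

Definition eval : YXH -> H :=
  @reduction_lift R (tensor_semi YP XH) H eval_tensor.

Lemma eval_lin : linear eval.
Proof.
exact: (@reduction_lift_lin R (tensor_semi YP XH) H _ eval_tensor_lin
  eval_tensor_null).
Qed.

Lemma eval_pi t : eval (induced_vec YP t) = eval_tensor t.
Proof.
exact: (@reduction_lift_pi R (tensor_semi YP XH) H _ eval_tensor_lin
  eval_tensor_null).
Qed.

Lemma eval_tens y s : eval (induced_vec YP (tens y s)) = peval_vec y s.
Proof. by rewrite eval_pi eval_tensor_tens. Qed.

Lemma eval_inner s s' : inner (eval s) (eval s') = inner s s'.
Proof.
rewrite -[s]induced_vec_surj -[s']induced_vec_surj !eval_pi.
by rewrite eval_tensor_inner induced_vec_inner.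
Qed.

Lemma eval_act a s : eval (rep_act a s) = rep_act a (eval s).
Proof.
elim/induced_ind: s => [|c y u s IH].
  by rewrite (lin0 (rep_linr a)) (lin0 eval_lin) (lin0 (rep_linr a)).
rewrite rep_linr !eval_lin rep_linr IH; congr (_ *: _ + _).
by rewrite [rep_act a _]induced_act_vec tact_tens !eval_tens peval_vec_lact.
Qed.

Lemma eval_surj : strongly_nondegenerate H -> forall h, exists s, eval s = h.
Proof.
move=> Hnd h; elim/span_ind: h / (Hnd h) => [|c _ v [a [z ->]] [s' <-]].
  by exists 0; rewrite (lin0 eval_lin).
suff [s sE] : exists s, eval s = rep_act a z.
  by exists (c *: s + s'); rewrite eval_lin sE.
elim/span_ind: a / (pair_full pP a) => [|d _ a [y [x ->]] [s sE]].
  by exists 0; rewrite (lin0 eval_lin) (lin0 (rep_linl z)).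
(* The class of y (x) [x (x) z] evaluates to [p y x] acting on [z]. *)
exists (d *: induced_vec YP (tens y (induced_vec XP (tens x z) : XH)) + s).
by rewrite eval_lin eval_tens peval_vec_tens sE rep_linl.
Qed.

End Evaluation.

(** * The inverse of evaluation, and naturality *)

Section EvaluationIso.
Context (k : intertwiner_kind) (H : starRep A) (Hnd : strongly_nondegenerate H).

Definition eval_inv (h : H) : induced_rep YP (induced_rep XP H) :=
  projT1 (cid (eval_surj Hnd h)).

Lemma eval_invK : cancel eval_inv (@eval H).
Proof. by move=> h; rewrite /eval_inv; case: cid. Qed.

(** An isometry is injective, so its right inverse is two-sided and the chosen preimages are the
    only ones. *)
Lemma evalK : cancel (@eval H) eval_inv.
Proof.
by move=> s; apply: (isometry_inj (@eval_lin H) (@eval_inner H)); rewrite eval_invK.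
Qed.

Lemma eval_adjoint : is_adjoint (@eval H) eval_inv.
Proof. by move=> s h; rewrite -[h in LHS]eval_invK eval_inner. Qed.

Definition eval_hom : intertwiner k (induced_rep YP (induced_rep XP H)) H :=
  Intertwiner (@eval_lin H) (@eval_act H)
    (of_kind_unitary k eval_adjoint evalK eval_invK).

(** Linearity and equivariance of the chosen inverse come from its being the adjoint of [eval]. *)
Definition eval_inv_hom : intertwiner k H (induced_rep YP (induced_rep XP H)) :=
  Intertwiner (adjoint_lin eval_adjoint) (adjoint_act eval_adjoint (@eval_act H))
    (of_kind_unitary k (is_adjoint_sym eval_adjoint) eval_invK evalK).

End EvaluationIso.

(** On the class of y (x) [x (x) h] both sides are [p y x] acting on [U h], since [U] commutes with
    the action; the outer and inner inductions reduce to this case. *)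
Lemma eval_natural (k : intertwiner_kind) (H K : starRep A)
    (U : intertwiner k H K) s :
  eval (induced_hom YP (induced_hom XP U) s) = U (eval s).
Proof.
set V := induced_hom XP U; set W := induced_hom YP V.
elim/induced_ind: s => [|c y u s IH].
  by rewrite (lin0 (intw_lin W)) !(lin0 (@eval_lin _)) (lin0 (intw_lin U)).
rewrite (intw_lin W) !eval_lin (intw_lin U) IH; congr (_ *: _ + _).
rewrite induced_hom_tens !eval_tens.
elim/induced_ind: u {s IH} => [|d x h u IH].
  rewrite (lin0 (intw_lin V)) !(lin0 (@peval_vec_lin _ _)).
  by rewrite (lin0 (intw_lin U)).
rewrite (intw_lin V) !peval_vec_lin (intw_lin U) IH; congr (_ *: _ + _).
by rewrite induced_hom_tens !peval_vec_tens intw_act.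
Qed.

Lemma rieffel_induction_inverse (k : intertwiner_kind)
    (Xnd : forall x : X, cspan (fun y => exists b (z : X), y = lact b z) x)
    (Ynd : forall y : Y, cspan (fun z => exists a (w : Y), z = lact a w) y) :
  naturally_isomorphic
    (comp_functor (rieffel_induction YP k Ynd) (rieffel_induction XP k Xnd))
    (id_functor (starRep_category k A)).
Proof.
exists (fun H : sndRep A => eval_hom k (@snd_nondeg R A H)); split.
  by move=> H K U; apply: intw_eq => s; apply: eval_natural.
move=> H; exists (eval_inv_hom k (@snd_nondeg R A H)).
by split; apply: intw_eq => s; [apply: evalK | apply: eval_invK].
Qed.

End Pairing.

(** * The two pairings carried by an equivalence bimodule *)

Section EquivalencePairings.
Context (R : realDomainType) (B A : starAlgebra R) (X : preEquivBimodule B A).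

Lemma rip_pairing :
  rieffel_pairing (X := X) (Y := conj_rieffel X) (fun y x => rip (y : X) x).
Proof.
split.
- move=> x c y z; rewrite [LHS]rip_sym (rip_lin x (cconj c) (y : X) (z : X)).
  by rewrite astar_antilin cconjK -!rip_sym.
- by move=> y; apply: (rip_lin (y : X)).
- move=> a y x; rewrite /= /conj_lact [LHS]rip_sym rip_ract astarM astarK.
  by rewrite -rip_sym.
- by move=> y x a; apply: (rip_ract (y : X)).
- by move=> y b x; rewrite /= /conj_ract rip_lact.
(* E3 trades the left action of [lip y y'] on [x'] for the right action of [rip y' x'] on [y], which
   X3 pulls out. *)
- by move=> y x y' x'; rewrite /= /conj_rip lip_rip rip_ract -rip_sym.
- exact: rip_full.
Qed.

Lemma lip_pairing :
  rieffel_pairing (X := conj_rieffel X) (Y := X) (fun x y => lip x (y : X)).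
Proof.
split.
- exact: lip_lin.
- exact: conj_rip_lin.
- exact: lip_lact.
- exact: (@conj_rip_ract R B A X).
- by move=> x a y; rewrite /= /conj_lact lip_ract.
(* E3 backwards: the right action of [rip x' x] on [y'] becomes the left action of [lip y' x'] on
   [x], which Y3 pulls out after Y2 swaps the arguments. *)
- move=> x y x' y'; rewrite /= /conj_lact /conj_rip -rip_sym -lip_rip.
  by rewrite [LHS]lip_sym lip_lact astarM -!lip_sym.
- exact: lip_full.
Qed.

End EquivalencePairings.

Theorem theorem5p10 (R : realDomainType) (A B : starAlgebra R)
    (X : equivBimodule B A) (Xnd : nondegenerate_bimodule X) (k : intertwiner_kind) :
  equivalence_of_categories
    (rieffel_functor k Xnd) (conj_rieffel_functor k Xnd).
Proof.
split.
- exact: (rieffel_induction_inverse (rip_pairing X)).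
- exact: (rieffel_induction_inverse (lip_pairing X)).
Qed.
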